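(* Consider a Gaussian observation model with parameter of interest $\theta\in\mathbb{R}^r$ and nuisance parameter $\eta\in\mathbb{R}^s$. Let $\bm I^{(L)}$ be the Fisher information matrix for $(\theta,\eta)$ at a fixed operating point after $L$ releases, with blocks $\bm I^{(L)}_{\theta\theta},\bm I^{(L)}_{\theta\eta},\bm I^{(L)}_{\eta\theta},\bm I^{(L)}_{\eta\eta}$, and let $\bm I_{\mathrm{eff}}^{(\theta),L}$ be the effective (nuisance-profiled) Fisher information. Add one independent scalar-output release, whose whitened gradient row at the operating point is $[a_{L+1}^\top\ \ b_{L+1}^\top]$ with $a_{L+1}\in\mathbb{R}^r$, $b_{L+1}\in\mathbb{R}^s$ (the noise law of the first $L$ releases being kept fixed). Then, in the Loewner order and without further assumptions, $$\bm I_{\mathrm{eff}}^{(\theta),L+1}\succeq \bm I_{\mathrm{eff}}^{(\theta),L}.$$ If moreover $\bm I_{\eta\eta}^{(L)}\succ \bm 0$, then with $$d_{L+1}:=a_{L+1}-\bm I_{\theta\eta}^{(L)}\bigl(\bm I_{\eta\eta}^{(L)}\bigr)^{-1}b_{L+1}$$ one has the exact rank-one update $$\bm I_{\mathrm{eff}}^{(\theta),L+1}=\bm I_{\mathrm{eff}}^{(\theta),L}+\frac{d_{L+1}d_{L+1}^\top}{1+b_{L+1}^\top\bigl(\bm I_{\eta\eta}^{(L)}\bigr)^{-1}b_{L+1}},$$ and hence $$\bm I_{\mathrm{eff}}^{(\theta),L+1}=\bm I_{\mathrm{eff}}^{(\theta),L}\iff d_{L+1}=\bm 0.$$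
   Context: Observation model: the $L$ released answers are stacked as $\bm y=\bm q(\theta,\eta)+\bm w\in\mathbb{R}^L$, where $\bm q$ is continuously differentiable near the operating point and $\bm w\sim\mathcal N(\bm 0,\bm\Sigma)$ with $\bm\Sigma\succ \bm 0$ not depending on the parameters. Let $\bm J=[\bm J_\theta\ \bm J_\eta]\in\mathbb{R}^{L\times(r+s)}$ be the Jacobian of $\bm q$ at the operating point. The Fisher information matrix is $$\bm I^{(L)}=\bm J^\top\bm\Sigma^{-1}\bm J=\begin{pmatrix}\bm I^{(L)}_{\theta\theta}&\bm I^{(L)}_{\theta\eta}\\ \bm I^{(L)}_{\eta\theta}&\bm I^{(L)}_{\eta\eta}\end{pmatrix}.$$ The effective Fisher information for $\theta$ is the generalized Schur complement $$\bm I_{\mathrm{eff}}^{(\theta),L}:=\bm I^{(L)}_{\theta\theta}-\bm I^{(L)}_{\theta\eta}\bigl(\bm I^{(L)}_{\eta\eta}\bigr)^{\dagger}\bm I^{(L)}_{\eta\theta},$$ where $\dagger$ is the Moore--Penrose pseudoinverse. Appending an independent scalar release $y_{L+1}=q_{L+1}(\theta,\eta)+w_{L+1}$ with $w_{L+1}\sim\mathcal N(0,\sigma_{L+1}^2)$, $\sigma_{L+1}>0$, independent of $\bm w$, appends the whitened row $[a_{L+1}^\top\ b_{L+1}^\top]=\sigma_{L+1}^{-1}[\nabla_\theta q_{L+1}^\top\ \nabla_\eta q_{L+1}^\top]$, so that $$\bm I^{(L+1)}=\bm I^{(L)}+\begin{bmatrix}a_{L+1}\\ b_{L+1}\end{bmatrix}[a_{L+1}^\top\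 b_{L+1}^\top],$$ and $\bm I_{\mathrm{eff}}^{(\theta),L+1}$ is defined from $\bm I^{(L+1)}$ in the same way. $\succeq$ denotes the Loewner order on symmetric matrices. *)

(* Defs.v *)
From mathcomp Require Import all_boot all_order all_algebra.
From mathcomp Require Import all_classical all_reals all_analysis.

Set Implicit Arguments.
Unset Strict Implicit.
Unset Printing Implicit Defensive.
Import Order.TTheory GRing.Theory Num.Theory.
Import numFieldNormedType.Exports.
Local Open Scope classical_set_scope.
Local Open Scope ring_scope.

Section MatrixNotions.
Context {R : realType}.

Definition qform n (A : 'M[R]_n) (x : 'cV[R]_n) : R := (x^T *m A *m x) 0 0.

Definition posdefmx n (A : 'M[R]_n) : Prop :=
  A^T = A /\ forall x : 'cV[R]_n, x != 0 -> 0 < qform A x.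

Definition loewner_ge n (A B : 'M[R]_n) : Prop :=
  [/\ A^T = A, B^T = B & forall x : 'cV[R]_n, 0 <= qform (A - B) x].

Definition penrose m n (A : 'M[R]_(m, n)) : set 'M[R]_(n, m) :=
  [set X | [/\ A *m X *m A = A, X *m A *m X = X,
               (A *m X)^T = A *m X & (X *m A)^T = X *m A]].

(* The default value 0 is never used: see mpinvP; mpinv_unique gives
   uniqueness. MathComp's pinvmx is a different, non-symmetric, inverse. *)
Definition mpinv m n (A : 'M[R]_(m, n)) : 'M[R]_(n, m) := xget 0 (penrose A).

Lemma gram_unit m n (A : 'M[R]_(m, n)) : row_free A -> A *m A^T \in unitmx.
Proof.
move=> fA; rewrite -row_free_unit -kermx_eq0.
apply/rowV0P => u /sub_kermxP; rewrite mulmxA => uAA.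
have : (u *m A) *m (u *m A)^T = 0 by rewrite trmx_mul mulmxA uAA mul0mx.
move=> /matrixP /(_ 0 0); rewrite !mxE => s0.
have uA0 : u *m A = 0.
  apply/matrixP => i j; rewrite ord1 [RHS]mxE.
  have ge0 k : true -> 0 <= (u *m A) 0 k * (u *m A)^T k 0.
    by move=> _; rewrite [_^T _ _]mxE -expr2 sqr_ge0.
  have /psumr_eq0P -/(_ ge0) /(_ j isT) := s0.
  by rewrite [_^T _ _]mxE -expr2 => /eqP; rewrite sqrf_eq0 => /eqP.
by apply: (row_free_inj fA); rewrite uA0 mul0mx.
Qed.

Lemma penrose_fullrank m k n (F : 'M[R]_(m, k)) (G : 'M[R]_(k, n)) :
  F^T *m F \in unitmx -> G *m G^T \in unitmx ->
  penrose (F *m G)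
    (G^T *m invmx (G *m G^T) *m (invmx (F^T *m F) *m F^T)).
Proof.
move=> FF GG; set X := (X in penrose _ X).
have AX : F *m G *m X = F *m invmx (F^T *m F) *m F^T.
  have GX : G *m X = invmx (F^T *m F) *m F^T.
    by rewrite /X !mulmxA mulmxV // mul1mx.
  by rewrite -mulmxA GX mulmxA.
have XA : X *m (F *m G) = G^T *m invmx (G *m G^T) *m G.
  have XF : X *m F = G^T *m invmx (G *m G^T).
    by rewrite /X -!mulmxA mulVmx // mulmx1.
  by rewrite mulmxA XF.
split.
- by rewrite AX -!mulmxA (mulmxA F^T) (mulmxA (invmx _)) mulVmx // mul1mx.
- rewrite XA {1}/X !mulmxA -(mulmxA _ G) -(mulmxA _ (G *m G^T)) mulmxV //.
  by rewrite mulmx1 /X !mulmxA.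
- by rewrite AX !trmx_mul trmx_inv trmx_mul !trmxK mulmxA.
- by rewrite XA !trmx_mul trmx_inv trmx_mul !trmxK mulmxA.
Qed.

Lemma mpinvP m n (A : 'M[R]_(m, n)) : penrose A (mpinv A).
Proof.
apply: xgetPex; eexists; rewrite -[in penrose A](mulmx_base A).
apply: penrose_fullrank; last exact: gram_unit (row_base_free A).
have := @gram_unit _ _ (col_base A)^T; rewrite trmxK; apply.
by rewrite /row_free mxrank_tr; exact: col_base_full.
Qed.

Lemma mpinv_unique m n (A : 'M[R]_(m, n)) X : penrose A X -> X = mpinv A.
Proof.
have := mpinvP A; move: (mpinv A) => Y [y1 y2 y3 y4] [x1 x2 x3 x4].
have E1 : A *m X = A *m Y.
  by rewrite -x3 -{1}y1 -mulmxA trmx_mul x3 y3 mulmxA x1.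
have E2 : X *m A = Y *m A.
  by rewrite -x4 -{1}y1 -(mulmxA A) mulmxA trmx_mul y4 x4 -mulmxA (mulmxA A) x1.
by rewrite -x2 E2 -mulmxA E1 mulmxA y2.
Qed.

End MatrixNotions.

Section GaussianModel.
Context {R : realType}.

(* The library's jacobian acts on row vectors on the right, hence is the
   transpose of the usual matrix of partial derivatives. *)
Definition Jac n L (q : 'rV[R]_n -> 'rV[R]_L) (p : 'rV[R]_n) : 'M[R]_(L, n) :=
  (jacobian q p)^T.

Definition grad n (f : 'rV[R]_n -> R) (p : 'rV[R]_n) : 'cV[R]_n :=
  \col_j 'D_(delta_mx 0 j) f p.

Definition C1_near n L (q : 'rV[R]_n -> 'rV[R]_L) (p : 'rV[R]_n) : Prop :=
  \forall x \near p, differentiable q x /\ {for x, continuous (Jac q)}.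

Definition C1_near_scalar n (f : 'rV[R]_n -> R) (p : 'rV[R]_n) : Prop :=
  \forall x \near p, differentiable f x /\ {for x, continuous (grad f)}.

(* Fisher information at p of y = q(p) + w, w ~ N(0, Sigma), where Sigma does
   not depend on the parameter. *)
Definition fisher n L (q : 'rV[R]_n -> 'rV[R]_L) (Sigma : 'M[R]_L)
    (p : 'rV[R]_n) : 'M[R]_n :=
  (Jac q p)^T *m invmx Sigma *m Jac q p.

(* The first r coordinates are the parameter of interest, the last s ones the
   nuisance parameter. *)
Definition eff_info r s (I : 'M[R]_(r + s)) : 'M[R]_r :=
  ulsubmx I - ursubmx I *m mpinv (drsubmx I) *m dlsubmx I.

Definition append_mean n L (q : 'rV[R]_n -> 'rV[R]_L) (f : 'rV[R]_n -> R) :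
    'rV[R]_n -> 'rV[R]_(L + 1) :=
  fun x => row_mx (q x) (f x)%:M.

(* Covariance of (w, w'), w ~ N(0, Sigma) and w' ~ N(0, sigma^2) independent. *)
Definition append_cov L (Sigma : 'M[R]_L) (sigma : R) : 'M[R]_(L + 1) :=
  block_mx Sigma 0 0 (sigma ^+ 2)%:M.

End GaussianModel.

(* Main.v *)
(** For a positive semidefinite information [I], completing the square gives
[[x; y]^T I [x; y] = x^T eff_info I x + (y - y0)^T C (y - y0)] with [C] the
nuisance block and [y0 = - C^+ I_eta_theta x], so
[x^T eff_info I x] is the minimum over [y] of the form of [I] at [(x, y)].  A
minimum of a larger form is larger, which gives monotonicity; the rank-one
update is the Sherman-Morrison formula for the nuisance block. *)

Require Import Defs.
From mathcomp Require Import all_boot all_order all_algebra.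
From mathcomp Require Import all_classical all_reals all_analysis.
From mathcomp Require Import ring.
Import Order.TTheory GRing.Theory Num.Theory.
Import numFieldNormedType.Exports.
Local Open Scope ring_scope.

(** * Positive semidefinite forms and Moore-Penrose inverses *)

Section PositiveSemidefinite.
Context {R : realType}.

(* Unlike these two lemmas, [mxE] also expands the entries of matrix products. *)
Lemma addmxE {m n} (A B : 'M[R]_(m, n)) i j : (A + B) i j = A i j + B i j.
Proof. by rewrite mxE. Qed.

Lemma scalemxE {m n} c (A : 'M[R]_(m, n)) i j : (c *: A) i j = c * A i j.
Proof. by rewrite mxE. Qed.

Definition possemidefmx {n} (A : 'M[R]_n) : Prop :=
  A^T = A /\ forall x : 'cV[R]_n, 0 <= qform A x.

Lemma sqnormE {n} (x : 'cV[R]_n) : (x^T *m x) 0 0 = \sum_i x i 0 ^+ 2.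
Proof. by rewrite mxE; apply: eq_bigr => i _; rewrite mxE expr2. Qed.

Lemma sqnorm_ge0 {n} (x : 'cV[R]_n) : 0 <= (x^T *m x) 0 0.
Proof. by rewrite sqnormE sumr_ge0 // => i _; rewrite sqr_ge0. Qed.

Lemma sqnorm_eq0 {n} (x : 'cV[R]_n) : (x^T *m x) 0 0 = 0 -> x = 0.
Proof.
rewrite sqnormE => /psumr_eq0P x0; apply/matrixP => i j; rewrite ord1 [RHS]mxE.
by apply/eqP; rewrite -sqrf_eq0 x0 // => k _; rewrite sqr_ge0.
Qed.

Lemma qformD {n} (A B : 'M[R]_n) x : qform (A + B) x = qform A x + qform B x.
Proof. by rewrite /qform mulmxDr mulmxDl mxE. Qed.

Lemma qformB {n} (A B : 'M[R]_n) x : qform (A - B) x = qform A x - qform B x.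
Proof. by rewrite /qform mulmxBr mulmxBl !mxE. Qed.

Lemma qform_congr {m n} (A : 'M[R]_m) (J : 'M[R]_(m, n)) x :
  qform (J^T *m A *m J) x = qform A (J *m x).
Proof. by rewrite /qform trmx_mul !mulmxA. Qed.

Lemma qform_outer {n} (g x : 'cV[R]_n) :
  qform (g *m g^T) x = (g^T *m x) 0 0 ^+ 2.
Proof.
rewrite /qform mulmxA -mulmxA mxE big_ord1 -[x^T *m g]trmxK mxE.
by rewrite trmx_mul trmxK expr2.
Qed.

Lemma posdefmx_unit {n} (A : 'M[R]_n) : posdefmx A -> A \in unitmx.
Proof.
move=> [AT A0]; rewrite -row_free_unit -kermx_eq0.
apply/rowV0P => u /sub_kermxP uA; apply/eqP/negP => /negP u0.
have := A0 u^T; rewrite trmx_eq0 => /(_ u0).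
by rewrite /qform trmxK uA mul0mx mxE ltxx.
Qed.

Lemma qform_invmx {n} (A : 'M[R]_n) x :
  posdefmx A -> qform (invmx A) x = qform A (invmx A *m x).
Proof.
move=> Apd; have Au := posdefmx_unit _ Apd; case: Apd => AT _.
by rewrite /qform trmx_mul trmx_inv AT !mulmxA mulmxKV.
Qed.

Lemma posdefmx_psd {n} (A : 'M[R]_n) : posdefmx A -> possemidefmx A.
Proof.
move=> [AT A0]; split=> // x; have [->|/A0/ltW//] := eqVneq x 0.
by rewrite /qform mulmx0 mxE.
Qed.

Lemma invmx_psd {n} (A : 'M[R]_n) : posdefmx A -> possemidefmx (invmx A).
Proof.
move=> Apd; have [AT A0] := posdefmx_psd _ Apd; split.
  by rewrite trmx_inv AT.
by move=> x; rewrite qform_invmx.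
Qed.

Lemma congr_psd {m n} (A : 'M[R]_m) (J : 'M[R]_(m, n)) :
  possemidefmx A -> possemidefmx (J^T *m A *m J).
Proof.
move=> [AT A0]; split; first by rewrite !trmx_mul trmxK AT mulmxA.
by move=> x; rewrite qform_congr.
Qed.

Lemma outer_psd {n} (g : 'cV[R]_n) : possemidefmx (g *m g^T).
Proof.
split; first by rewrite trmx_mul trmxK.
by move=> x; rewrite qform_outer sqr_ge0.
Qed.

(** The diagonal entries of [g *m g^T] are the squares of the entries of [g]. *)
Lemma outer_eq0 {n} (g : 'cV[R]_n) : g *m g^T = 0 -> g = 0.
Proof.
move=> /matrixP g0; apply/matrixP => i j; rewrite ord1 [RHS]mxE.
apply/eqP; rewrite -sqrf_eq0 expr2.
by have := g0 i i; rewrite !mxE big_ord1 mxE => ->.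
Qed.

Lemma psdD {n} (A B : 'M[R]_n) :
  possemidefmx A -> possemidefmx B -> possemidefmx (A + B).
Proof.
move=> [AT A0] [BT B0]; split; first by rewrite linearD /= AT BT.
by move=> x; rewrite qformD addr_ge0.
Qed.

(** A nonnegative form that vanishes at [z] is minimal there, so its derivative at [z] is zero in
    every direction. The direction [A *m z] gives the squared norm of [A *m z]. *)
Lemma psd_ker {n} (A : 'M[R]_n) (z : 'cV[R]_n) :
  possemidefmx A -> qform A z = 0 -> A *m z = 0.
Proof.
move=> [AT A0] z0; apply: sqnorm_eq0.
set w := A *m z; set m : R := (w^T *m w) 0 0.
have m0 : 0 <= m by exact: sqnorm_ge0.
have wq0 := A0 w; set k := qform A w in wq0.
have zAw : (z^T *m A *m w) 0 0 = m.
  by rewrite /m {2}/w trmx_mul AT.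
have wAz : (w^T *m A *m z) 0 0 = m by rewrite -mulmxA.
(* The minimiser in t of t^2 k + 2 t m, with k + 1 > 0 in place of k. *)
pose t := - m / (k + 1).
have := A0 (t *: w + z).
have -> : qform A (t *: w + z) = t ^+ 2 * k + 2 * t * m.
  have trE : (t *: w + z)^T = t *: w^T + z^T by rewrite linearD linearZ.
  rewrite /qform trE !mulmxDl !mulmxDr -!scalemxAl -!scalemxAr.
  rewrite !addmxE !scalemxE zAw wAz -/(qform A w) -/(qform A z) z0 -/k.
  ring.
have k1 : 0 < k + 1 by rewrite ltr_wpDl.
have -> : t ^+ 2 * k + 2 * t * m = - (m ^+ 2 * (k + 2) / (k + 1) ^+ 2).
  by rewrite /t; field; rewrite gt_eqF.
(* Since [k + 2] and [k + 1] are positive, nonnegativity of the form forces [m ^+ 2 <= 0]. *)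
rewrite oppr_ge0 pmulr_lle0 ?invr_gt0 ?exprn_gt0 // pmulr_lle0 ?ltr_wpDl //.
by rewrite real_exprn_even_le0 ?num_real //= => /eqP.
Qed.

(** Transposition preserves the first two Penrose equations and exchanges the last two, so
    uniqueness applies. *)
Lemma mpinv_tr {m n} (A : 'M[R]_(m, n)) : (mpinv A)^T = mpinv A^T.
Proof.
apply: mpinv_unique; have [A1 A2 A3 A4] := mpinvP A; split.
- by rewrite -!trmx_mul mulmxA A1.
- by rewrite -!trmx_mul mulmxA A2.
- by rewrite -trmx_mul !A4.
- by rewrite -trmx_mul !A3.
Qed.

Lemma mpinv_unit {n} (A : 'M[R]_n) : A \in unitmx -> mpinv A = invmx A.
Proof.
move=> Au; symmetry; apply: mpinv_unique; split.
- by rewrite mulmxV ?mul1mx.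
- by rewrite mulVmx ?mul1mx.
- by rewrite mulmxV ?trmx1.
- by rewrite mulVmx ?trmx1.
Qed.

End PositiveSemidefinite.

(** * Effective information: completed square and monotonicity *)

Section EffectiveInformation.
Context {R : realType} {r s : nat}.
Implicit Types (I : 'M[R]_(r + s)) (x : 'cV[R]_r) (y : 'cV[R]_s).

Lemma tr_dlsubmx I : I^T = I -> dlsubmx I = (ursubmx I)^T.
Proof. by move=> IT; rewrite -{1}IT trmx_ursub. Qed.

Lemma eff_info_tr I : I^T = I -> (eff_info I)^T = eff_info I.
Proof.
move=> IT; rewrite /eff_info linearB /= !trmx_mul mpinv_tr.
by rewrite trmx_ulsub trmx_drsub trmx_ursub trmx_dlsub IT mulmxA.
Qed.

Lemma qform_block I x y : I^T = I ->
  qform I (col_mx x y) = qform (ulsubmx I) x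
    + 2 * (y^T *m dlsubmx I *m x) 0 0 + qform (drsubmx I) y.
Proof.
move=> IT; rewrite /qform -{1}(submxK I) tr_col_mx mul_row_block mul_row_col.
rewrite !mulmxDl !addmxE.
(* The two cross terms are 1 x 1 matrices and transposes of each other. *)
have -> : (x^T *m ursubmx I *m y) 0 0 = (y^T *m dlsubmx I *m x) 0 0.
  rewrite tr_dlsubmx // -[x^T *m _ *m y]trmxK mxE.
  by rewrite !trmx_mul trmxK mulmxA.
by rewrite addrACA -!addrA; congr (_ + _); ring.
Qed.

Lemma psd_drsubmx I : possemidefmx I -> possemidefmx (drsubmx I).
Proof.
move=> [IT I0]; split; first by rewrite trmx_drsub IT.
move=> y; have := I0 (col_mx 0 y).
by rewrite qform_block // {1}/qform !mulmx0 !mxE mulr0 !add0r.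
Qed.

(** The range of the off-diagonal block is contained in that of the nuisance
block, since the kernel of the latter is killed by the whole matrix. *)
Lemma psd_ursubmx_mpinv I : possemidefmx I ->
  ursubmx I *m mpinv (drsubmx I) *m drsubmx I = ursubmx I.
Proof.
move=> Ipsd; have [IT I0] := Ipsd.
set C := drsubmx I; have [C1 _ _ _] := mpinvP C.
have kerC (y : 'cV_s) : C *m y = 0 -> ursubmx I *m y = 0.
  move=> Cy; have : I *m col_mx 0 y = 0.
    apply: psd_ker => //; rewrite qform_block // /qform !mulmx0 -/C.
    by rewrite -mulmxA Cy mulmx0 !mxE mulr0 !addr0.
  rewrite -{1}(submxK I) mul_block_col !mulmx0 !add0r => /eqP.
  by rewrite col_mx_eq0 => /andP[/eqP].
apply/eqP; rewrite eq_sym -subr_eq0 -mulmxA -{1}(mulmx1 (ursubmx I)) -mulmxBr.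
apply/eqP/matrixP => i j.
(* By the first Penrose equation, the columns of [1 - C^+ C] lie in the kernel of [C]. *)
have /kerC/matrixP/(_ i 0) : C *m col j (1%:M - mpinv C *m C) = 0.
  by rewrite colE mulmxA mulmxBr mulmx1 mulmxA C1 subrr mul0mx.
by rewrite colE mulmxA -colE mxE => ->; rewrite !mxE.
Qed.

Lemma eff_info_square I x y : possemidefmx I ->
  qform I (col_mx x y) = qform (eff_info I) x
    + qform (drsubmx I) (y + mpinv (drsubmx I) *m dlsubmx I *m x).
Proof.
move=> Ipsd; have IT := Ipsd.1; rewrite qform_block // /eff_info qformB.
have BPC := psd_ursubmx_mpinv _ Ipsd; have DE := tr_dlsubmx _ IT.
have := (psd_drsubmx _ Ipsd).1.
move: BPC DE; set B := ursubmx I; set C := drsubmx I; set D := dlsubmx I.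
set P := mpinv C => BPC DE CT.
have PT : P^T = P by rewrite mpinv_tr CT.
(* The transpose of [BPC], as [P] and [C] are symmetric. *)
have CPD : C *m P *m D = D.
  by rewrite DE -{2}BPC !trmx_mul PT CT mulmxA.
(* [CPD] and [BPC] remove [C] from the cross terms and from the term quadratic in [x]; the latter
   becomes exactly what the Schur complement subtracts. *)
have -> : qform C (y + P *m D *m x) = qform C y + 2 * (y^T *m D *m x) 0 0
    + qform (B *m P *m D) x.
  have trE : (y + P *m D *m x)^T = y^T + (P *m D *m x)^T by rewrite linearD.
  rewrite /qform trE !trmx_mul PT DE trmxK -DE.
  rewrite !mulmxDl !mulmxDr !mulmxA.
  have -> : y^T *m C *m P = y^T *m (C *m P) by rewrite mulmxA.
  have -> : x^T *m B *m P *m C = x^T *m B by rewrite -!mulmxA (mulmxA B) BPC.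
  rewrite -(mulmxA y^T (C *m P)) CPD.
  have -> : (x^T *m B *m y) = (y^T *m D *m x)^T.
    by rewrite !trmx_mul trmxK DE trmxK mulmxA.
  rewrite !addmxE (mxE trmx_key).
  ring.
ring.
Qed.

Lemma eff_info_le {I I'} : possemidefmx I -> possemidefmx I' ->
  (forall z, qform I z <= qform I' z) -> loewner_ge (eff_info I') (eff_info I).
Proof.
move=> Ipsd Ipsd' leI; split; [exact/eff_info_tr/Ipsd'.1|exact/eff_info_tr/Ipsd.1|].
move=> x; rewrite qformB subr_ge0.
pose y := - (mpinv (drsubmx I') *m dlsubmx I' *m x).
have := leI (col_mx x y).
rewrite !eff_info_square // [in X in _ <= _ + X]/y addNr.
rewrite [qform _ 0]/qform mulmx0 [in X in _ <= _ + X]mxE addr0.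
by apply: le_trans; rewrite lerDl (psd_drsubmx I Ipsd).2.
Qed.

(** * Rank-one update for a positive definite nuisance block *)

Lemma eff_info_rank1 I (a : 'cV[R]_r) (b : 'cV[R]_s) :
  let C := drsubmx I in
  let g := col_mx a b in
  let d := a - ursubmx I *m invmx C *m b in
  I^T = I -> posdefmx C ->
  eff_info (I + g *m g^T) = eff_info I
    + (1 + (b^T *m invmx C *m b) 0 0)^-1 *: (d *m d^T).
Proof.
move=> C g d IT Cpd; have DE := tr_dlsubmx _ IT.
have Cu := posdefmx_unit _ Cpd.
have CVT : (invmx C)^T = invmx C by rewrite trmx_inv Cpd.1.
pose B := ursubmx I.
(* Opaque, so that mulmxA does not unfold them. *)
have [u uE] : {u | u = invmx C *m b} by exists (invmx C *m b).
have [v vE] : {v | v = B *m u} by exists (B *m u).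
pose beta := (b^T *m u) 0 0; pose gamma := 1 + beta.
have beta0 : 0 <= beta by rewrite /beta uE mulmxA; exact: (invmx_psd _ Cpd).2.
have gamma0 : gamma != 0 by rewrite gt_eqF // ltr_wpDr.
have ggE : I + g *m g^T = block_mx (ulsubmx I + a *m a^T) (B + a *m b^T)
    (B^T + b *m a^T) (C + b *m b^T).
  rewrite -{1}(submxK I) DE tr_col_mx mul_col_row.
  by rewrite add_block_mx.
have bu : b^T *m u = beta%:M by exact: mx11_scalar.
have uT : u^T = b^T *m invmx C by rewrite uE trmx_mul CVT.
have Cuu : C *m u = b by rewrite uE mulmxA mulmxV ?mul1mx.
(* Sherman-Morrison: the candidate is checked as a right inverse, which suffices for square
   matrices. *)
have [C'u C'V] : C + b *m b^T \in unitmx /\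
    invmx (C + b *m b^T) = invmx C - gamma^-1 *: (u *m u^T).
  set C' := C + _; set X := _ - _.
  have C'X : C' *m X = 1%:M.
    rewrite mulmxDl !mulmxBr mulmxV // -!scalemxAr !mulmxA Cuu.
    rewrite -(mulmxA b b^T u) bu -(mulmxA b _ (invmx C)) -uT.
    rewrite mul_mx_scalar -scalemxAl scalerA.
    set M := b *m u^T; rewrite -[X in _ + (X - _)]scale1r -scalerBl.
    rewrite -addrA -scaleNr -scalerDl.
    have -> : - gamma^-1 + (1 - gamma^-1 * beta) = 0.
      by rewrite /gamma; field.
    by rewrite scale0r addr0.
  have [C'u _] := mulmx1_unit C'X; split=> //.
  by rewrite -[RHS](mulKmx C'u) C'X mulmx1.
rewrite {1}/eff_info ggE block_mxKul block_mxKur block_mxKdl block_mxKdr.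
rewrite mpinv_unit // C'V /eff_info mpinv_unit // DE -/B -/C.
have uTb : u^T *m b = beta%:M.
  by rewrite -[LHS]trmxK trmx_mul trmxK bu tr_scalar_mx.
have vT : u^T *m B^T = v^T by rewrite vE trmx_mul.
have BCV : (B + a *m b^T) *m invmx C *m (B^T + b *m a^T) =
    B *m invmx C *m B^T + v *m a^T + a *m v^T + beta *: (a *m a^T).
  rewrite mulmxDl -(mulmxA a b^T) -uT mulmxDl !mulmxDr !mulmxA.
  rewrite -(mulmxA B _ b) -uE -vE -(mulmxA a u^T b) uTb mul_mx_scalar -scalemxAl.
  by rewrite -(mulmxA a) vT !addrA.
have Bu : (B + a *m b^T) *m u = v + beta *: a.
  by rewrite mulmxDl -vE -mulmxA bu mul_mx_scalar.
have uB : u^T *m (B^T + b *m a^T) = (v + beta *: a)^T.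
  by rewrite -Bu trmx_mul [in RHS]linearD /= trmx_mul trmxK.
rewrite mulmxBr mulmxBl BCV -scalemxAr -scalemxAl mulmxA Bu -(mulmxA _ u^T) uB.
have -> : (b^T *m invmx C *m b) 0 0 = beta by rewrite -mulmxA -uE.
have -> : d = a - v by rewrite /d vE uE mulmxA.
rewrite -/gamma; set N := B *m invmx C *m B^T.
(* The term [N] cancels. As [beta = gamma - 1], the vector [v + beta a] equals [gamma a - (a - v)],
   and what remains collapses entrywise to [gamma^-1 (a - v) (a - v)^T]. *)
apply/matrixP => i j; rewrite !mxE !big_ord1 !mxE /gamma.
by field; exact: gamma0.
Qed.

End EffectiveInformation.

(** * Jacobian and Fisher information of the extended model *)

Section AppendedRelease.
Context {R : realType}.

(** Expresses [Jac] by the directional derivatives that define [grad], so that the two can be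
    stacked. *)
Lemma JacE {n L} (q : 'rV[R]_n -> 'rV[R]_L) p i j : differentiable q p ->
  Jac q p i j = 'D_(delta_mx 0 j) (fun x => q x 0 i) p.
Proof.
move=> dq; rewrite /Jac /jacobian !mxE -deriveE // derive_mx ?mxE //.
exact: diff_derivable.
Qed.

Lemma differentiable_append_mean {n L} (q : 'rV[R]_n -> 'rV[R]_L) f p :
  differentiable q p -> differentiable f p ->
  differentiable (append_mean q f) p.
Proof.
move=> dq df.
(* Expanding in the standard basis reduces the claim to scalar coordinates, each of which is a
   coordinate of [q] or [f] itself. *)
have -> : append_mean q f =
    \sum_(j < L + 1) (fun x => append_mean q f x 0 j *: delta_mx 0 j).
  by apply/funext => x; rewrite fct_sumE; exact: row_sum_delta.
apply: differentiable_sum => j; apply: differentiableZl.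
have [k ->|k ->] := split_ordP j.
  rewrite (_ : (fun x => _) = (fun N : 'rV_L => N 0 k) \o q).
    by apply: differentiable_comp => //; exact: differentiable_coord.
  by apply/funext => x; rewrite /append_mean row_mxEl.
rewrite (_ : (fun x => _) = f) //; apply/funext => x.
by rewrite /append_mean row_mxEr !ord1 mxE eqxx mulr1n.
Qed.

Lemma Jac_append_mean {n L} (q : 'rV[R]_n -> 'rV[R]_L) f p :
  differentiable q p -> differentiable f p ->
  Jac (append_mean q f) p = col_mx (Jac q p) (grad f p)^T.
Proof.
move=> dq df; apply/matrixP => i j.
rewrite JacE; last exact: differentiable_append_mean.
have [k ->|k ->] := split_ordP i.
  rewrite col_mxEu JacE //; congr ('D_ _ _ p).
  by apply/funext => x; rewrite /append_mean row_mxEl.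
rewrite col_mxEd !mxE; congr ('D_ _ _ p).
by apply/funext => x; rewrite /append_mean row_mxEr !ord1 mxE eqxx mulr1n.
Qed.

(** Independence makes the covariance block diagonal, so its inverse splits and the new release
    contributes [sigma^-2] times the outer product of its gradient. *)
Lemma fisher_append {n L} (q : 'rV[R]_n -> 'rV[R]_L) f (Sigma : 'M[R]_L)
    (sigma : R) p : differentiable q p -> differentiable f p ->
  Sigma \in unitmx -> 0 < sigma ->
  let g := sigma^-1 *: grad f p in
  fisher (append_mean q f) (append_cov Sigma sigma) p
    = fisher q Sigma p + g *m g^T.
Proof.
move=> dq df Su s0 g.
have s2u : (sigma ^+ 2)%:M \in @unitmx R 1.
  by rewrite unitmxE det_scalar1 unitfE expf_neq0 // gt_eqF.
rewrite /fisher Jac_append_mean // /append_cov invmx_block_diag; last first.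
  by rewrite block_diag_mx_unit Su.
rewrite tr_col_mx trmxK mul_row_block !mulmx0 addr0 add0r mul_row_col.
congr (_ + _); rewrite invmx_scalar mul_mx_scalar /g linearZ /=.
rewrite -!scalemxAl -scalemxAr.
by rewrite scalerA -expr2 exprVn.
Qed.

End AppendedRelease.

Theorem theorem1 (R : realType) (r s L : nat)
    (theta : 'rV[R]_r) (eta : 'rV[R]_s)
    (q : 'rV[R]_(r + s) -> 'rV[R]_L) (Sigma : 'M[R]_L)
    (q' : 'rV[R]_(r + s) -> R) (sigma : R)
    (hq : C1_near q (row_mx theta eta)) (hSigma : posdefmx Sigma)
    (hq' : C1_near_scalar q' (row_mx theta eta)) (hsigma : 0 < sigma) :
  let p := row_mx theta eta in
  let I := fisher q Sigma p in
  let I' := fisher (append_mean q q') (append_cov Sigma sigma) p in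
  let a : 'cV[R]_r := sigma^-1 *: usubmx (grad q' p) in
  let b : 'cV[R]_s := sigma^-1 *: dsubmx (grad q' p) in
  let Iee := drsubmx I in
  let d := a - ursubmx I *m invmx Iee *m b in
  loewner_ge (eff_info I') (eff_info I) /\
  (posdefmx Iee ->
     eff_info I' = eff_info I
       + (1 + (b^T *m invmx Iee *m b) 0 0)^-1 *: (d *m d^T) /\
     (eff_info I' = eff_info I <-> d = 0)).
Proof.
move=> p I I' a b Iee d.
have dq : differentiable q p := (nbhs_singleton hq).1.
have dq' : differentiable q' p := (nbhs_singleton hq').1.
have Ipsd : possemidefmx I by exact/congr_psd/invmx_psd.
pose g := sigma^-1 *: grad q' p.
have I'E : I' = I + g *m g^T.
  by apply: fisher_append => //; exact: posdefmx_unit.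
have gE : g = col_mx a b by rewrite /a /b -scale_col_mx vsubmxK.
split.
  apply: eff_info_le => //; first by rewrite I'E; exact/psdD/outer_psd.
  by move=> z; rewrite I'E qformD lerDl (outer_psd g).2.
move=> Cpd; have upd : eff_info I' = eff_info I
    + (1 + (b^T *m invmx Iee *m b) 0 0)^-1 *: (d *m d^T).
  by rewrite I'E gE; apply: eff_info_rank1 => //; exact: Ipsd.1.
split=> //; rewrite upd; split=> [|->]; last first.
  by rewrite mul0mx scaler0 addr0.
(* After cancellation a multiple of [d *m d^T] is zero; the scalar is the inverse of a number at
   least 1, hence nonzero. *)
rewrite -[RHS]addr0 => /addrI/eqP.
rewrite scaler_eq0 invr_eq0 => /orP[|/eqP dd0].
  by rewrite gt_eqF // ltr_wpDr // (invmx_psd _ Cpd).2.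
exact: outer_eq0.
Qed.
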